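(* Let $d,e\ge 1$, and let $\mathcal{P}\subset\mathbb{R}^d$ and $\mathcal{Q}\subset\mathbb{R}^e$ be integral convex polytopes of dimension $d$ and $e$ containing the origins $\mathbf{0}_d$ and $\mathbf{0}_e$, respectively. Suppose that $\mathbb{Z}(\mathcal{P}\cap\mathbb{Z}^d)=\mathbb{Z}^d$, $\mathbb{Z}(\mathcal{Q}\cap\mathbb{Z}^e)=\mathbb{Z}^e$, and $$(\mathcal{P}\oplus\mathcal{Q})\cap\mathbb{Z}^{d+e}=\mu(\mathcal{P}\cap\mathbb{Z}^d)\cup\nu(\mathcal{Q}\cap\mathbb{Z}^e).$$ Then the free sum $\mathcal{P}\oplus\mathcal{Q}$ possesses the integer decomposition property if and only if the following two conditions hold: (1) each of $\mathcal{P}$ and $\mathcal{Q}$ possesses the integer decomposition property; (2) either $\mathcal{P}$ or $\mathcal{Q}$ has the property that the equation of each of its facets is of the form $\sum_{i=1}^{f}a_iz_i=b$ with each $a_i\in\mathbb{Z}$ and $b\in\{0,1\}$, where $f$ is the dimension of the ambient space of that polytope ($f=d$ for $\mathcal{P}$, $f=e$ for $\mathcal{Q}$).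
   Context: An integral convex polytope is a convex polytope all of whose vertices have integer coordinates. For a set $S\subset\mathbb{Z}^k$, $\mathbb{Z}S$ denotes the subgroup of $\mathbb{Z}^k$ generated by $S$. Define $\mu:\mathbb{R}^d\to\mathbb{R}^{d+e}$ by $\mu(\alpha)=(\alpha,\mathbf{0}_e)$ and $\nu:\mathbb{R}^e\to\mathbb{R}^{d+e}$ by $\nu(\beta)=(\mathbf{0}_d,\beta)$. The free sum $\mathcal{P}\oplus\mathcal{Q}$ is the convex hull of $\mu(\mathcal{P})\cup\nu(\mathcal{Q})$ in $\mathbb{R}^{d+e}$. For $n\ge1$, $n\mathcal{P}=\{n\alpha:\alpha\in\mathcal{P}\}$. An integral convex polytope $\mathcal{P}\subset\mathbb{R}^d$ possesses the integer decomposition property if for every $n\ge1$ and every $\gamma\in n\mathcal{P}\cap\mathbb{Z}^d$ there exist $\gamma^{(1)},\dots,\gamma^{(n)}\in\mathcal{P}\cap\mathbb{Z}^d$ with $\gamma=\gamma^{(1)}+\cdots+\gamma^{(n)}$. ''The equation of a facet is of the form $\sum a_iz_i=b$'' means the affine hyperplane spanned by the facet equals $\{z:\sum_{i=1}^f a_iz_i=b\}$ for some such integers $a_i$ and $b\in\{0,1\}$. *)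

(* Defs.v *)
From HB Require Import structures.
From mathcomp Require Import all_boot all_order all_algebra.
From mathcomp Require Import boolp classical_sets cardinality reals convex.

Set Implicit Arguments.
Unset Strict Implicit.
Unset Printing Implicit Defensive.

Import Order.TTheory GRing.Theory Num.Theory.

Local Open Scope classical_set_scope.
Local Open Scope ring_scope.

Section Polytopes.
Context {R : realType}.

Definition dotp d (a z : 'rV[R]_d) : R := \sum_i a 0 i * z 0 i.

Definition lattice d : set 'rV[R]_d := [set x | x \is a mxOver Num.int].

Definition conv d (A : set 'rV[R]_d) : set 'rV[R]_d :=
  smallest (@convex_set R 'rV[R]_d) A.

Definition aff d (A : set 'rV[R]_d) : set 'rV[R]_d :=
  [set x | exists (n : nat) (c : 'I_n -> R) (p : 'I_n -> 'rV[R]_d),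
     [/\ forall i, A (p i), \sum_i c i = 1 & x = \sum_i c i *: p i]].

(* The empty set has no dimension in this sense. *)
Definition has_dim d (A : set 'rV[R]_d) (k : nat) : Prop :=
  exists (x0 : 'rV[R]_d) (V : {vspace 'rV[R]_d}),
    aff A = [set x0 + v | v in [set` V]] /\ \dim V = k.

Definition polytope d (P : set 'rV[R]_d) : Prop :=
  exists2 A : set 'rV[R]_d, finite_set A & P = conv A.

(* The improper faces P (a = 0, b = 0) and set0 are included. *)
Definition face d (P F : set 'rV[R]_d) : Prop :=
  exists (a : 'rV[R]_d) (b : R),
    (forall z, P z -> dotp a z <= b) /\ F = P `&` [set z | dotp a z = b].

Definition vertex d (P : set 'rV[R]_d) (v : 'rV[R]_d) : Prop :=
  face P [set v].

Definition facet d (P F : set 'rV[R]_d) : Prop :=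
  face P F /\ exists k, has_dim P k.+1 /\ has_dim F k.

Definition integral_polytope d (P : set 'rV[R]_d) : Prop :=
  polytope P /\ vertex P `<=` @lattice d.

Definition ZZspan d (S : set 'rV[R]_d) : set 'rV[R]_d :=
  smallest (fun H : set 'rV[R]_d => zmod_closed [in H]) S.

Definition mu d e (x : 'rV[R]_d) : 'rV[R]_(d + e) := row_mx x 0.

Definition nu d e (y : 'rV[R]_e) : 'rV[R]_(d + e) := row_mx 0 y.

Definition free_sum d e (P : set 'rV[R]_d) (Q : set 'rV[R]_e) :
    set 'rV[R]_(d + e) :=
  conv ((@mu d e @` P) `|` (@nu d e @` Q)).

Definition dilate d (n : nat) (P : set 'rV[R]_d) : set 'rV[R]_d :=
  [set n%:R *: x | x in P].

Definition has_IDP d (P : set 'rV[R]_d) : Prop :=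
  forall n : nat, (1 <= n)%N ->
  forall g : 'rV[R]_d, (dilate n P `&` @lattice d) g ->
  exists h : 'I_n -> 'rV[R]_d,
    (forall i, (P `&` @lattice d) (h i)) /\ g = \sum_i h i.

(* The hyperplane spanned by a facet F is aff F. *)
Definition facet_equations01 d (P : set 'rV[R]_d) : Prop :=
  forall F, facet P F ->
  exists (a : 'I_d -> int) (b : int),
    (b = 0 \/ b = 1) /\
    aff F = [set z : 'rV[R]_d | \sum_i (a i)%:~R * z 0 i = b%:~R].

End Polytopes.

(* Main.v *)
(**
For x in a dilate of P write |x| for the least t >= 0 with x in tP. A point (x, y)
lies in n(P (+) Q) iff |x| + |y| <= n, and all facet equations of P have the
required form iff |x| is an integer at every lattice point x of the cone over P.
If it is, a lattice point (x, y) of n(P (+) Q) splits as x in kP and y in (n - k)Q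
with k = |x|.
If it fails for both summands, suitable multiples give lattice points x and y
whose |x| and |y| have fractional parts in ]0, 1/2]; then (x, y) lies in
n(P (+) Q) with n = floor |x| + floor |y| + 1, but writing x and y as sums of
lattice points of P and Q needs ceil |x| + ceil |y| = n + 1 summands.
*)
Require Import Defs.
From HB Require Import structures.
From mathcomp Require Import all_boot all_order all_algebra.
From mathcomp Require Import boolp classical_sets cardinality reals convex.
From mathcomp Require Import interval_inference ring lra zify.
Set Implicit Arguments.
Unset Strict Implicit.
Unset Printing Implicit Defensive.
Import Order.TTheory GRing.Theory Num.Theory.
Local Open Scope classical_set_scope.
Local Open Scope ring_scope.

(** * Separation of a point from a finitely generated cone *)

Section ScalarProduct.
Context {R : realType} {d : nat}.
Implicit Types (a z : 'rV[R]_d) (c : R).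

Lemma dotpC a z : dotp a z = dotp z a.
Proof. by apply: eq_bigr => i _; rewrite mulrC. Qed.

Lemma dotpDr a y z : dotp a (y + z) = dotp a y + dotp a z.
Proof. by rewrite /dotp -big_split; apply: eq_bigr => i _; rewrite mxE mulrDr. Qed.

Lemma dotpZr a c z : dotp a (c *: z) = c * dotp a z.
Proof. by rewrite /dotp big_distrr; apply: eq_bigr => i _; rewrite mxE mulrCA. Qed.

Lemma dotpNr a z : dotp a (- z) = - dotp a z.
Proof. by rewrite -scaleN1r dotpZr mulN1r. Qed.

Lemma dotpBr a y z : dotp a (y - z) = dotp a y - dotp a z.
Proof. by rewrite dotpDr dotpNr. Qed.

Lemma dotp0r a : dotp a 0 = 0.
Proof. by rewrite -(scale0r 0) dotpZr mul0r. Qed.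

Lemma dotp_sumr a m (v : 'I_m -> 'rV[R]_d) :
  dotp a (\sum_i v i) = \sum_i dotp a (v i).
Proof. by elim/big_rec2: _ => [|i x y _ <-]; rewrite ?dotp0r ?dotpDr. Qed.

Lemma dotpDl a y z : dotp (a + y) z = dotp a z + dotp y z.
Proof. by rewrite dotpC dotpDr !(dotpC z). Qed.

Lemma dotpZl a c z : dotp (c *: a) z = c * dotp a z.
Proof. by rewrite dotpC dotpZr dotpC. Qed.

Lemma dotpNl a z : dotp (- a) z = - dotp a z.
Proof. by rewrite dotpC dotpNr dotpC. Qed.

Lemma dotpBl a y z : dotp (a - y) z = dotp a z - dotp y z.
Proof. by rewrite dotpDl dotpNl. Qed.

Lemma dotp0l z : dotp 0 z = 0.
Proof. by rewrite dotpC dotp0r. Qed.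

Lemma dotp_delta a i : dotp a (delta_mx 0 i) = a 0 i.
Proof.
rewrite /dotp (bigD1 i) //= big1 => [|j ji]; rewrite mxE eqxx /=.
  by rewrite eqxx mulr1 addr0.
by rewrite (negPf ji) mulr0.
Qed.

Lemma dotpp_ge0 a : 0 <= dotp a a.
Proof. by apply: sumr_ge0 => i _; rewrite -expr2 sqr_ge0. Qed.

Lemma dotpp_eq0 a : (dotp a a == 0) = (a == 0).
Proof.
apply/idP/eqP => [|->]; last by rewrite dotp0l.
rewrite psumr_eq0 => [/allP aa0|i _]; last by rewrite -expr2 sqr_ge0.
apply/rowP => i; have := aa0 i; rewrite mem_index_enum mxE => /(_ isT).
by rewrite mulf_eq0 orbb => /eqP.
Qed.

Lemma hyperplane_point a c : a != 0 -> exists y, dotp a y = c.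
Proof.
move=> a0; exists ((c / dotp a a) *: a).
by rewrite dotpZr divfK // dotpp_eq0.
Qed.

(** The component of [a'] orthogonal to [a] lies in the kernel of [a], hence in that of [a'], so it
    is orthogonal to itself. *)
Lemma dotp_proportional a a' :
  a != 0 -> (forall w, dotp a w = 0 -> dotp a' w = 0) ->
  exists c, a' = c *: a.
Proof.
move=> a0 aa'; exists (dotp a' a / dotp a a).
set c := _ / _; apply/eqP; rewrite -subr_eq0 -dotpp_eq0; apply/eqP.
have aw : dotp a (a' - c *: a) = 0.
  by rewrite dotpBr dotpZr /c divfK ?dotpp_eq0 // dotpC subrr.
by rewrite dotpBl dotpZl aw aa' // mulr0 subrr.
Qed.

End ScalarProduct.

Lemma dotp_row_mx (R : realType) (d e : nat) (a y : 'rV[R]_d) (b z : 'rV[R]_e) :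
  dotp (row_mx a b) (row_mx y z) = dotp a y + dotp b z.
Proof.
rewrite /dotp big_split_ord; congr (_ + _); apply: eq_bigr => i _.
  by rewrite !row_mxEl.
by rewrite !row_mxEr.
Qed.

Section Cones.
Context {R : realType} {d : nat}.

Definition cone m (v : 'I_m -> 'rV[R]_d) : set 'rV[R]_d :=
  [set x | exists2 c : 'I_m -> R, forall i, 0 <= c i & x = \sum_i c i *: v i].

(* Induction on the number of generators: if a functional a separating x from
   the other generators is positive on v_0, project along v_0 onto its kernel. *)
Lemma farkas m (v : 'I_m -> 'rV[R]_d) x : ~ cone v x ->
  exists2 f, (forall i, dotp f (v i) <= 0) & 0 < dotp f x.
Proof.
elim: m v x => [|m IHm] v x vx.
  exists x; first by case.
  rewrite lt_def dotpp_ge0 dotpp_eq0 andbT; apply/eqP => x0; apply: vx.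
  by exists (fun=> 0) => //; rewrite big_ord0.
pose v' i := v (lift ord0 i).
have [a av' ax] : exists2 f, (forall i, dotp f (v' i) <= 0) & 0 < dotp f x.
  apply: IHm => -[c c0 xE]; apply: vx.
  exists (fun i => if unlift ord0 i is Some j then c j else 0) => [i|].
    by case: unliftP.
  rewrite big_ord_recl unlift_none scale0r add0r xE.
  by apply: eq_bigr => i _; rewrite liftK.
have [av0|av0] := leP (dotp a (v ord0)) 0.
  by exists a => // i; case: (unliftP ord0 i) => [j|] -> //; exact: av'.
pose p y := y - (dotp a y / dotp a (v ord0)) *: v ord0.
have [b bv' bx] : exists2 f, (forall i, dotp f (p (v' i)) <= 0)
    & 0 < dotp f (p x).
  apply: (IHm (p \o v')) => -[c c0 xE]; apply: vx.
  (* Lifting a conic expression of [p x] back to [x] gives [v ord0] the weight (a x - sum of c_j a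
     v'_j) / a v_0, nonnegative since a x > 0 and each a v'_j <= 0. *)
  exists (fun i => if unlift ord0 i is Some j then c j else
    dotp a x / dotp a (v ord0)
    - \sum_j c j * (dotp a (v' j) / dotp a (v ord0))) => [i|].
    case: unliftP => [j|] _ //; rewrite subr_ge0 (@le_trans _ _ 0) //.
      apply: sumr_le0 => j _; rewrite mulr_ge0_le0 // mulr_le0_ge0 //.
      by rewrite invr_ge0 ltW.
    by rewrite divr_ge0 // ltW.
  rewrite big_ord_recl unlift_none.
  rewrite [X in _ + X](eq_bigr (fun j => c j *: v' j)); last first.
    by move=> j _; rewrite liftK.
  move: xE => /eqP; rewrite /p subr_eq => /eqP {1}->.
  rewrite scalerBl -addrA [RHS]addrC; congr (_ + _).
  rewrite addrC scaler_suml -sumrB; apply: eq_bigr => j _.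
  by rewrite /= /p scalerBr scalerA.
(* [c] is [b] composed with [p], so it vanishes on [v ord0]. *)
pose c := b - (dotp b (v ord0) / dotp a (v ord0)) *: a.
have cE y : dotp c y = dotp b (p y).
  by rewrite /c /p dotpBl dotpBr dotpZl dotpZr mulrAC [in RHS]mulrAC
    (mulrC (dotp b _)).
exists c; last by rewrite cE.
move=> i; case: (unliftP ord0 i) => [j ->|->]; rewrite cE; first exact: bv'.
by rewrite /p divff ?gt_eqF // scale1r subrr dotp0r.
Qed.

(* Among the functionals separating x, take one vanishing on as many generators
   as possible: it cannot be tilted, inside the functionals vanishing on the same
   generators and at x, without stopping at a further generator. *)
Lemma farkas_tight m (v : 'I_m -> 'rV[R]_d) x :
  (forall f, (forall i, dotp f (v i) = 0) -> f = 0) -> ~ cone v x ->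
  exists f, [/\ forall i, dotp f (v i) <= 0, 0 < dotp f x &
    forall g, (forall i, dotp f (v i) = 0 -> dotp g (v i) = 0) ->
      exists c, g = c *: f].
Proof.
move=> vspan /farkas [f0 f0v f0x].
pose tight f := #|[set i | dotp f (v i) == 0]%SET|.
have [k] := ubnP (m - tight f0)%N; elim: k => // k IHk in f0 f0v f0x *.
move=> f0k; have [|] := pselect (forall g,
  (forall i, dotp f0 (v i) = 0 -> dotp g (v i) = 0) -> exists c, g = c *: f0).
  by exists f0.
move=> /existsNP[g /not_implyP[g0 /forallNP gf0]].
(* The multiple of [f0] makes the tilting direction vanish at [x], so tilting keeps the value at
   [x]. *)
pose u := g - (dotp g x / dotp f0 x) *: f0.
have ux : dotp u x = 0 by rewrite /u dotpBl dotpZl divfK ?subrr // gt_eqF.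
have uT i : dotp f0 (v i) = 0 -> dotp u (v i) = 0.
  by move=> fi; rewrite /u dotpBl dotpZl fi mulr0 g0 // subrr.
have [i ui] : exists i, dotp u (v i) != 0.
  apply/not_existsP => u0; apply: (gf0 (dotp g x / dotp f0 x)).
  apply/eqP; rewrite -subr_eq0 -/u; apply/eqP/vspan => i.
  by apply/eqP/negP => /negP /(u0 i).
have [h [hx hT [j hj]]] : exists h, [/\ dotp h x = 0,
    forall i, dotp f0 (v i) = 0 -> dotp h (v i) = 0 &
    exists i, 0 < dotp h (v i)].
  have [ui'|ui'|ui'] := ltgtP (dotp u (v i)) 0; last by rewrite ui' eqxx in ui.
    exists (- u); split; [by rewrite dotpNl ux oppr0| |].
      by move=> j fj; rewrite dotpNl uT ?oppr0.
    by exists i; rewrite dotpNl oppr_gt0.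
  by exists u; split=> //; exists i.
(* Tilting by [s j] makes the functional vanish at [v j]; at the least such parameter no generator
   has yet become positive. *)
pose s j := - dotp f0 (v j) / dotp h (v j).
case: (@Order.TotalTheory.arg_minP _ _ _ j (fun j => 0 < dotp h (v j)) s hj).
move=> {}j {}hj sj.
have sj0 : 0 <= s j by rewrite divr_ge0 ?oppr_ge0 // ltW.
pose f1 := f0 + s j *: h.
have f1E y : dotp f1 y = dotp f0 y + s j * dotp h y by rewrite dotpDl dotpZl.
apply: (IHk f1) => [l||].
- rewrite f1E; have [hl|hl] := leP (dotp h (v l)) 0.
    by rewrite -[leRHS]addr0 lerD // mulr_ge0_le0.
  by rewrite -lerBrDl sub0r -ler_pdivlMr // sj.
- by rewrite f1E hx mulr0 addr0.
- have f01 : (tight f0 < tight f1)%N.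
    apply: proper_card; apply/fintype.properP; split.
      apply/fintype.subsetP => l; rewrite !inE f1E => /eqP fl.
      by rewrite fl hT // mulr0 addr0.
    exists j; rewrite !inE; last by apply: contraTneq hj => /hT ->; rewrite ltxx.
    rewrite f1E /s divfK; last by rewrite gt_eqF.
    by rewrite subrr eqxx.
  have : (tight f1 <= m)%N by rewrite -[leqRHS]card_ord max_card.
  by move: f0k f01; lia.
Qed.

End Cones.

(** * Polytopes, vertices and facets *)

Section ConvexHulls.
Context {R : realType} {d : nat}.
Implicit Types (A B : set 'rV[R]_d).

Lemma convex_setP A : convex_set A <->
  forall x y t, 0 <= t -> t <= 1 -> A x -> A y -> A (t *: x + (1 - t) *: y).
Proof.
split=> [cA x y t t0 t1 Ax Ay|cA x y t /set_mem Ax /set_mem Ay].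
  by have /set_mem := cA x y (Itv01 t0 t1) (mem_set Ax) (mem_set Ay).
by apply/mem_set; apply: cA.
Qed.

Lemma convex_comb A m (c : 'I_m -> R) v : convex_set A ->
  (forall i, 0 <= c i) -> \sum_i c i = 1 -> (forall i, A (v i)) ->
  A (\sum_i c i *: v i).
Proof.
move=> cA; elim: m c v => [|m IHm] c v c0 c1 Av.
  by move/eqP: c1; rewrite big_ord0 eq_sym oner_eq0.
move: c1; rewrite !big_ord_recl => c1.
have cE : \sum_(i < m) c (lift ord0 i) = 1 - c ord0 by rewrite -c1 addrAC subrr add0r.
have [c01|c01] := eqVneq (c ord0) 1.
  rewrite c01 scale1r big1 ?addr0 // => i _.
  move/eqP: cE; rewrite c01 subrr psumr_eq0 // => /allP /(_ i).
  by rewrite mem_index_enum => /(_ isT) /eqP ->; rewrite scale0r.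
have lt0 : 0 < 1 - c ord0.
  by rewrite lt_def subr_eq0 eq_sym c01 -cE sumr_ge0.
rewrite (_ : \sum_(i < m) _ = (1 - c ord0) *:
    \sum_(i < m) (c (lift ord0 i) / (1 - c ord0)) *: v (lift ord0 i)).
  move/convex_setP: cA; apply => //; first by rewrite -subr_ge0 ltW.
  apply: IHm => [i||i //]; first by rewrite divr_ge0 // ltW.
  by rewrite -mulr_suml cE divff // gt_eqF.
rewrite scaler_sumr; apply: eq_bigr => i _.
by rewrite scalerA mulrC divfK // gt_eqF.
Qed.

Lemma convex_conv A : convex_set (Defs.conv A).
Proof.
apply/convex_setP => x y t t0 t1 Ax Ay B [cB AB].
by move/convex_setP: (cB); apply => //; [exact: Ax|exact: Ay].
Qed.

Lemma sub_conv A : A `<=` Defs.conv A.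
Proof. exact: sub_gen_smallest. Qed.

Lemma conv_sub A B : convex_set B -> A `<=` B -> Defs.conv A `<=` B.
Proof. exact: smallest_sub. Qed.

Lemma conv_rangeP m (v : 'I_m -> 'rV[R]_d) x :
  Defs.conv (range v) x <-> exists c : 'I_m -> R,
    [/\ forall i, 0 <= c i, \sum_i c i = 1 & x = \sum_i c i *: v i].
Proof.
split=> [|[c [c0 c1 ->]]]; last first.
  apply: convex_comb => // [|i]; first exact: convex_conv.
  by apply: sub_conv; exists i.
move: x; apply: conv_sub.
  apply/convex_setP => _ _ t t0 t1 [c [c0 c1 ->]] [c' [c'0 c'1 ->]].
  exists (fun i => t * c i + (1 - t) * c' i); split=> [i||].
  - by rewrite addr_ge0 // mulr_ge0 // subr_ge0.
  - by rewrite big_split -!mulr_sumr c1 c'1 /=; ring.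
  - rewrite !scaler_sumr -big_split; apply: eq_bigr => i _.
    by rewrite /= [RHS]scalerDl !scalerA.
move=> _ [i _ <-]; exists (fun j => (j == i)%:R); split=> [j||].
- by rewrite ler0n.
- by rewrite (bigD1 i) //= eqxx big1 ?addr0 // => j /negPf ->.
- rewrite (bigD1 i) //= eqxx scale1r big1 ?addr0 // => j /negPf ->.
  by rewrite scale0r.
Qed.

Lemma polytope_range (P : set 'rV[R]_d) : polytope P ->
  exists m (v : 'I_m -> 'rV[R]_d), P = Defs.conv (range v).
Proof.
move=> [A /finite_seqP[s ->] ->]; exists (size s), (tnth (in_tuple s)).
congr Defs.conv; apply/seteqP; split=> [x /= /(tnthP (in_tuple s))[i ->]|].
  by exists i.
by move=> _ [i _ <-]; exact: mem_tnth.
Qed.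

(** Lifting to height 1 turns convex combinations into conic ones and affine functions into linear
    ones, so that the results on cones apply. *)
Definition homog (z : 'rV[R]_d) : 'rV[R]_(1 + d) := row_mx 1 z.

Lemma dotp_homog (f : 'rV[R]_(1 + d)) z :
  dotp f (homog z) = dotp (rsubmx f) z + f 0 (lshift d 0).
Proof.
rewrite -[in LHS](hsubmxK f) dotp_row_mx addrC; congr (_ + _).
by rewrite /dotp big_ord1 !mxE eqxx mulr1.
Qed.

Lemma homog_comb m (v : 'I_m -> 'rV[R]_d) (c : 'I_m -> R) z :
  homog z = \sum_i c i *: homog (v i) <->
  \sum_i c i = 1 /\ z = \sum_i c i *: v i.
Proof.
have -> : \sum_i c i *: homog (v i) =
    row_mx (\sum_i c i)%:M (\sum_i c i *: v i).
  rewrite -[LHS]hsubmxK; congr row_mx; apply/matrixP => i j.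
    rewrite !mxE summxE !ord1 eqxx mulr1n; apply: eq_bigr => k _.
    by rewrite mxE row_mxEl mxE eqxx mulr1.
  by rewrite !(mxE, summxE); apply: eq_bigr => k _; rewrite mxE row_mxEr mxE !ord1.
split=> [/eq_row_mx[c1 zE]|[-> <-] //].
by split=> //; have := congr1 (fun A : 'M_1 => A 0 0) c1; rewrite !mxE eqxx.
Qed.

Lemma cone_homogP m (v : 'I_m -> 'rV[R]_d) x :
  cone (homog \o v) (homog x) <-> Defs.conv (range v) x.
Proof.
rewrite conv_rangeP; split=> [[c c0 /homog_comb[c1 xE]]|[c [c0 c1 xE]]].
  by exists c.
by exists c => //; apply/homog_comb.
Qed.

(** The nonnegative terms c_i (b - a v_i) add up to b - a z = 0, so only generators on the
    hyperplane carry weight. *)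
Lemma face_comb m (v : 'I_m -> 'rV[R]_d) a b z :
  (forall i, dotp a (v i) <= b) -> Defs.conv (range v) z -> dotp a z = b ->
  exists c : 'I_m -> R, [/\ forall i, 0 <= c i,
    forall i, dotp a (v i) != b -> c i = 0, \sum_i c i = 1 &
    z = \sum_i c i *: v i].
Proof.
move=> avb /conv_rangeP[c [c0 c1 zE]] az; exists c; split=> // i aib.
move/eqP: az; rewrite eq_sym zE dotp_sumr -subr_eq0 -[b]mul1r -c1 mulr_suml.
rewrite -sumrB psumr_eq0 => [/allP/(_ i)|j _]; last first.
  by rewrite dotpZr -mulrBr mulr_ge0 // subr_ge0.
rewrite mem_index_enum dotpZr -mulrBr mulf_eq0 subr_eq0 [b == _]eq_sym (negPf aib) orbF.
by move=> /(_ isT) /eqP.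
Qed.

(* A generator that is not redundant is separated from the hull of the others,
   and the separating functional attains its maximum only there. *)
Lemma polytope_vertices (P : set 'rV[R]_d) : polytope P ->
  exists m (v : 'I_m -> 'rV[R]_d),
    P = Defs.conv (range v) /\ forall i, vertex P (v i).
Proof.
move=> /polytope_range[m0 [v0 Pv0]].
pose gen m := `[< exists v : 'I_m -> 'rV[R]_d, P = Defs.conv (range v) >].
have exgen : exists m, gen m by exists m0; apply/asboolP; exists v0.
(* A generating family of least size has no redundant member. *)
case: (ex_minnP exgen) => m /asboolP[v PE] mmin.
exists m, v; split=> // i.
case: m => [|m] in v PE mmin i *; first by case: i.
have [|vi] := pselect (Defs.conv (range (v \o lift i)) (v i)).
  move=> vi; suff /mmin : gen m by rewrite ltnn.
  apply/asboolP; exists (v \o lift i); rewrite PE; apply/seteqP; split.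
    apply: conv_sub; first exact: convex_conv.
    move=> _ [j _ <-]; case: (unliftP i j) => [k|] -> //.
    by apply: sub_conv; exists k.
  apply: conv_sub; first exact: convex_conv.
  by move=> _ [j _ <-]; apply: sub_conv; exists (lift i j).
have /farkas[f fv fi] : ~ cone (homog \o (v \o lift i)) (homog (v i)).
  by move/cone_homogP.
pose a := rsubmx f.
have av j : j != i -> dotp a (v j) < dotp a (v i).
  case: (unliftP i j) => [k ->|->]; last by rewrite eqxx.
  by have := le_lt_trans (fv k) fi; rewrite /= !dotp_homog ltrD2r.
have avi j : dotp a (v j) <= dotp a (v i).
  by have [->//|/av/ltW] := eqVneq j i.
exists a, (dotp a (v i)); split.
  move=> z; rewrite PE => /conv_rangeP[c [c0 c1 ->]].
  rewrite dotp_sumr -[leRHS]mul1r -c1 mulr_suml ler_sum // => j _.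
  by rewrite dotpZr ler_wpM2l.
apply/seteqP; split=> [_ ->|z [+ /=]].
  by split=> //; rewrite PE; apply: sub_conv; exists i.
rewrite PE => /(face_comb avi) /[apply] -[c [_ cv c1 ->]].
have cj j : j != i -> c j = 0 by move=> ji; rewrite cv // lt_eqF // av.
have ci : c i = 1.
  by rewrite -c1 (bigD1 i) //= big1 => [|j /cj //]; rewrite addr0.
rewrite (bigD1 i) //= big1 => [|j /cj ->]; last by rewrite scale0r.
by rewrite addr0 ci scale1r.
Qed.

(** On P the functional [dotp x] is bounded through its values at the generators, while at N x it
    equals N times [dotp x x]. *)
Lemma polytope_bounded (P : set 'rV[R]_d) x :
  polytope P -> (forall N, P (N%:R *: x)) -> x = 0.
Proof.
move=> /polytope_range[m [v ->]] Px; apply/eqP; rewrite -dotpp_eq0.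
apply: contraT => x0; pose M := \sum_i `|dotp x (v i)|.
have Mx N : N%:R * dotp x x <= M.
  have /conv_rangeP[c [c0 c1 xE]] := Px N.
  rewrite -dotpZr xE dotp_sumr ler_sum // => i _; rewrite dotpZr.
  have ci1 : c i <= 1 by rewrite -c1 (bigD1 i) //= lerDl sumr_ge0.
  apply: le_trans (ler_norm _) _; rewrite normrM ger0_norm //.
  by rewrite ler_piMl.
have xx0 : 0 < dotp x x by rewrite lt_def x0 dotpp_ge0.
have := Mx (Num.bound (M / dotp x x)); rewrite -ler_pdivlMr // leNgt.
have M0 : 0 <= M by apply: sumr_ge0.
by rewrite archi_boundP // divr_ge0 // ltW.
Qed.

End ConvexHulls.

(** * Facets: their hyperplanes, and separation by a facet *)

Section Facets.
Context {R : realType} {d : nat}.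
Implicit Types (a z : 'rV[R]_d) (A P F : set 'rV[R]_d).

Lemma aff_sub_hyperplane A a b : (forall z, A z -> dotp a z = b) ->
  aff A `<=` [set z | dotp a z = b].
Proof.
move=> Ab _ [n [c [p [Ap c1 ->]]]] /=; rewrite dotp_sumr.
under eq_bigr => i _ do rewrite dotpZr Ab //.
by rewrite -mulr_suml c1 mul1r.
Qed.

(** Points of weight 0 may lie outside [A]; they are replaced by a point of nonzero weight, which
    exists since the weights add up to 1. *)
Lemma aff_comb A m (c : 'I_m -> R) p : (forall i, c i != 0 -> A (p i)) ->
  \sum_i c i = 1 -> aff A (\sum_i c i *: p i).
Proof.
move=> Ap c1; have [i0 ci0] : exists i0, c i0 != 0.
  apply/not_existsP => c0; move/eqP: c1; rewrite big1 ?(eq_sym 0) ?oner_eq0 //.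
  by move=> i _; apply/eqP/negP => /negP /(c0 i).
exists m, c, (fun i => if c i == 0 then p i0 else p i); split=> // [i|].
  by case: eqVneq => [_|]; exact: Ap.
by apply: eq_bigr => i _; case: eqVneq => // ->; rewrite !scale0r.
Qed.

Lemma hyperplane_vspace a : a != 0 -> exists V : {vspace 'rV[R]_d},
  (forall w, w \in V <-> dotp a w = 0) /\ (\dim V).+1 = d.
Proof.
(* Packaging the functional as a linear map makes its kernel a [{vspace}], and rank-nullity gives
   the dimension. *)
move=> a0; pose phi : 'rV[R]_d -> R^o := dotp a.
have phiL : linear phi by move=> c x y; rewrite /phi dotpDr dotpZr.
pose phiM := GRing.isLinear.Build R 'rV[R]_d R^o *:%R phi phiL.
pose phiP : {linear 'rV[R]_d -> R^o} := HB.pack phi phiM.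
exists (lker (linfun phiP)); split=> [w|].
  by rewrite memv_ker lfunE /=; split=> [/eqP //|aw]; apply/eqP.
have := limg_ker_dim (linfun phiP) fullv; rewrite capfv dimvf.
have -> : \dim (limg (linfun phiP)) = 1%N.
  apply/eqP; rewrite eqn_leq (leq_trans (dimvS (subvf _))) /=; last first.
    by rewrite dimvf.
  rewrite lt0n dimv_eq0; apply: contra a0 => /eqP im0.
  rewrite -dotpp_eq0 -(memv0 (dotp a a : R^o)) -im0.
  by rewrite -[dotp a a](lfunE phiP) memv_img // memvf.
by rewrite addn1 dim_matrix mul1r.
Qed.

(** The direction space is determined by the affine hull, as its vectors are the differences of
    points of the hull. *)
Lemma has_dim_uniq A k l : has_dim A k -> has_dim A l -> k = l.
Proof.
suff sub (x0 x1 : 'rV[R]_d) (V W : {vspace 'rV[R]_d}) :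
    [set x0 + v | v in [set` V]] = [set x1 + v | v in [set` W]] -> (V <= W)%VS.
  move=> [x0 [V [AV <-]]] [x1 [W [AW <-]]]; congr (\dim _); apply/eqP.
  by rewrite eqEsubv; apply/andP; split; [apply: (sub x0 x1)|apply: (sub x1 x0)];
    rewrite -AV -AW.
move=> VW; apply/subvP => v Vv.
have [w0 Ww0 x0E] : [set x1 + v | v in [set` W]] x0.
  by rewrite -VW; exists 0; rewrite ?addr0 //= mem0v.
have [w Ww vE] : [set x1 + v | v in [set` W]] (x0 + v).
  by rewrite -VW; exists v.
have -> : v = w - w0 by rewrite -[LHS](addKr x0) -vE -x0E addrC (addrC x1 w) addrKA.
exact: memvB.
Qed.

Lemma full_dim_aff P : has_dim P d -> aff P = setT.
Proof.
move=> [x0 [V [-> dV]]]; apply/seteqP; split=> // z _.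
exists (z - x0); last by rewrite addrC subrK.
suff -> : V = fullv by exact: memvf.
by apply/eqP; rewrite eqEdim subvf dimvf dV /= dim_matrix mul1r.
Qed.

Lemma facet_hyperplane P F : has_dim P d -> facet P F ->
  exists a b, [/\ a != 0, forall z, P z -> dotp a z <= b,
    F = P `&` [set z | dotp a z = b] & aff F = [set z | dotp a z = b]].
Proof.
move=> dimP [[a [b [Pab FE]]] [k [Pk Fk]]].
have kd : k.+1 = d := has_dim_uniq Pk dimP.
have Fab : aff F `<=` [set z | dotp a z = b].
  by apply: aff_sub_hyperplane => z; rewrite FE => -[].
have a0 : a != 0.
  (* With a = 0 the face is improper: it is P, of the wrong dimension, if b = 0, and otherwise
     empty, hence without dimension. *)
  apply/eqP => a0; have [b0|b0] := eqVneq b 0.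
    have FP : F = P.
      rewrite FE; apply/seteqP; split=> [z []|z Pz] //.
      by split=> //=; rewrite a0 b0 dotp0l.
    by have /n_Sn := has_dim_uniq Fk (eq_ind_r (fun P => has_dim P _) Pk FP).
  case: Fk => [x0 [V [FV _]]].
  have : aff F x0 by rewrite FV; exists 0; rewrite ?addr0 //= mem0v.
  by move=> /Fab /= /esym /eqP; rewrite a0 dotp0l (negPf b0).
exists a, b; split=> //; apply/seteqP; split=> //.
case: Fk => [x1 [W [FW dW]]]; have [V [VE dV]] := hyperplane_vspace a0.
have ax1 : dotp a x1 = b.
  by apply: Fab; rewrite FW; exists 0; rewrite ?addr0 //= mem0v.
have WV : W = V.
  apply/eqP; rewrite eqEdim dW -ltnS dV kd leqnn andbT.
  apply/subvP => w Ww; apply/VE; have : aff F (x1 + w) by rewrite FW; exists w.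
  by move/Fab => /= /eqP; rewrite dotpDr ax1 -subr_eq0 addrAC subrr add0r => /eqP.
move=> z /= az; rewrite FW; exists (z - x1); last by rewrite addrC subrK.
by rewrite /= WV; apply/VE; rewrite dotpBr az ax1 subrr.
Qed.

Lemma facet_of_hyperplane P a b : has_dim P d -> a != 0 ->
  (forall z, P z -> dotp a z <= b) ->
  [set z | dotp a z = b] `<=` aff (P `&` [set z | dotp a z = b]) ->
  facet P (P `&` [set z | dotp a z = b]).
Proof.
move=> dimP a0 Pab aF; split; first by exists a, b.
have [V [VE dV]] := hyperplane_vspace a0.
exists (\dim V); split; first by rewrite dV.
have [x0 ax0] := hyperplane_point b a0; exists x0, V; split=> //.
apply/seteqP; split=> [z /(aff_sub_hyperplane (fun _ => @proj2 _ _)) /= az|].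
  exists (z - x0); last by rewrite addrC subrK.
  by apply/VE; rewrite dotpBr az ax0 subrr.
move=> _ [w /VE aw <-]; apply: aF.
by rewrite /= dotpDr ax0 aw addr0.
Qed.

(** [farkas_tight] on the homogenized generators gives a functional determined up to scaling by the
    generators it vanishes on, and these span its hyperplane. The last clause serves to compare (a,
    b) with another equation of the same hyperplane. *)
Lemma facet_separation P x : polytope P -> has_dim P d -> ~ P x ->
  exists a b, let F := P `&` [set z | dotp a z = b] in
  [/\ forall z, P z -> dotp a z <= b, b < dotp a x, facet P F,
    aff F = [set z | dotp a z = b] & 
    forall a' b', (forall z, dotp a z = b -> dotp a' z = b') ->
      exists c, a' = c *: a /\ b' = c * b].
Proof.
move=> /polytope_range[m [v PE]] dimP; have affP := full_dim_aff dimP.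
have Pv i : P (v i) by rewrite PE; apply: sub_conv; exists i.
have [i0 _] : exists i : 'I_m, True.
  have : aff P 0 by rewrite affP.
  move=> [[|n] [c [p [Pp c1 _]]]].
    by move/eqP: c1; rewrite big_ord0 eq_sym oner_eq0.
  case: m => [|m] in v PE Pv *; last by exists ord0.
  have := Pp ord0; rewrite PE => /conv_rangeP[c' [_ /eqP]].
  by rewrite big_ord0 eq_sym oner_eq0.
rewrite {1}PE => /cone_homogP /farkas_tight[f f0|f [fv fx fT]].
  (* A functional vanishing on all homogenized generators is an affine function that is zero on P,
     hence on its affine hull, the whole space. *)
  have af z : dotp (rsubmx f) z = - f 0 (lshift d 0).
    have : aff P z by rewrite affP.
    apply: aff_sub_hyperplane => {}z; rewrite PE => /cone_homogP[c _ zE].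
    apply/eqP; rewrite -addr_eq0 -dotp_homog zE dotp_sumr big1 // => i _.
    by rewrite dotpZr f0 mulr0.
  have fl : f 0 (lshift d 0) = 0.
    by apply/eqP; rewrite -oppr_eq0 -(af 0) dotp0r.
  rewrite -[f]hsubmxK -[RHS](row_mx0 _ _ 1 d); congr row_mx.
    by apply/matrixP => i j; rewrite !ord1 !mxE fl.
  by apply/eqP; rewrite -dotpp_eq0 af fl oppr0.
pose a := rsubmx f; pose b := - f 0 (lshift d 0).
have fE z : dotp f (homog z) = dotp a z - b by rewrite dotp_homog opprK.
have Pab z : P z -> dotp a z <= b.
  rewrite PE -subr_le0 -fE => /cone_homogP[c c0 ->].
  by rewrite dotp_sumr sumr_le0 // => i _; rewrite dotpZr mulr_ge0_le0 // fv.
have bx : b < dotp a x by rewrite -subr_gt0 -fE.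
have a0 : a != 0.
  apply: contraTneq bx => a0; rewrite -leNgt.
  by have := Pab _ (Pv i0); rewrite a0 !dotp0l.
have FT : [set z | dotp a z = b] `<=` aff (P `&` [set z | dotp a z = b]).
  move=> y /= ay; pose T i := dotp f (homog (v i)) == 0.
  pose M : 'M[R]_(m, 1 + d) := \matrix_(i < m) if T i then homog (v i) else 0.
  have /submxP[D] : (homog y <= M)%MS.
    rewrite submxE; apply/eqP/rowP => j; rewrite [RHS]mxE.
    (* A column of the cokernel vanishes on all tight generators, so it is a multiple of [f], which
       vanishes at [homog y]. *)
    pose g := (col j (cokermx M))^T.
    have gE k (A : 'M_(k, 1 + d)) i : (A *m cokermx M) i j = dotp g (row i A).
      by rewrite mxE; apply: eq_bigr => l _; rewrite !mxE mulrC.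
    have [c gc] : exists c, g = c *: f.
      apply: fT => i fi; have := gE _ M i; rewrite mulmx_coker mxE rowK.
      by rewrite /T fi eqxx.
    rewrite gE gc dotpZl; have -> : row 0 (homog y) = homog y.
      by apply/rowP => k; rewrite mxE.
    by rewrite fE ay subrr mulr0.
  rewrite mulmx_sum_row => yE.
  have /homog_comb[c1 ->] : homog y = \sum_i (if T i then D 0 i else 0) *: homog (v i).
    rewrite yE; apply: eq_bigr => i _; rewrite rowK.
    by case: (T i); rewrite ?scale0r ?scaler0.
  apply: aff_comb c1 => i; case: ifP => [Ti _|]; last by rewrite eqxx.
  by split=> //=; apply/eqP; rewrite -subr_eq0 -fE.
exists a, b; split=> //.
- exact: facet_of_hyperplane.
- apply/seteqP; split=> //.
  exact: (aff_sub_hyperplane (fun _ => @proj2 _ _)).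
move=> a' b' ab'; pose g : 'rV[R]_(1 + d) := row_mx (- b')%:M a'.
have gE z : dotp g (homog z) = dotp a' z - b'.
  by rewrite dotp_homog row_mxKr row_mxEl mxE eqxx mulr1n.
have [c gc] : exists c, g = c *: f.
  apply: fT => i /eqP; rewrite fE gE subr_eq0 => /eqP /ab' ->.
  exact: subrr.
exists c; split; first by rewrite -[LHS](row_mxKr (- b')%:M) -/g gc linearZ.
apply: oppr_inj; rewrite /b mulrN opprK.
have := congr1 (fun h : 'rV_(1 + d) => h 0 (lshift d 0)) gc.
by rewrite [RHS]mxE row_mxEl mxE eqxx mulr1n.
Qed.

End Facets.

(** * Integral facet equations and dilation factors of lattice points *)

Section Dilations.
Context {R : realType} {d : nat}.
Implicit Types (a x y z : 'rV[R]_d) (P F : set 'rV[R]_d).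

Lemma dotp_lattice a x : @lattice R d a -> @lattice R d x ->
  dotp a x \is a Num.int.
Proof.
move=> /mxOverP aZ /mxOverP xZ; apply: rpred_sum => i _.
by rewrite rpredM ?aZ ?xZ.
Qed.

Lemma int_row_lattice (a : 'I_d -> int) : @lattice R d (\row_i (a i)%:~R).
Proof. by apply/mxOverP => i j; rewrite mxE intr_int. Qed.

Lemma dotp_int_row (a : 'I_d -> int) z :
  dotp (\row_i (a i)%:~R) z = \sum_i (a i)%:~R * z 0 i.
Proof. by apply: eq_bigr => i _; rewrite mxE. Qed.

Lemma int_le_truncn (r t : R) : r \is a Num.int -> 0 <= t -> r <= t ->
  r <= (Num.truncn t)%:R.
Proof.
move=> /intrP[m ->] t0 mt; have /andP[_ tk] := truncn_itv t0.
have := le_lt_trans mt tk; rewrite !(pmulrn 1) ltr_int ler_int; lia.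
Qed.

(** With integral coefficients and right side 0 or 1, the inequality a x <= t b at a lattice point
    survives rounding t down. *)
Lemma facet_equations01_truncn P x p t : polytope P -> has_dim P d -> P 0 ->
  facet_equations01 P -> @lattice R d x -> P p -> 0 <= t -> x = t *: p ->
  exists2 p', P p' & x = (Num.truncn t)%:R *: p'.
Proof.
move=> Ppoly dimP P0 P01 xZ Pp t0 xE; set k := Num.truncn t.
(* Every facet inequality a z <= b of P gives a x <= k b. *)
have Psx s : 0 <= s -> s * k%:R <= 1 -> P (s *: x).
  move=> s0 sk; apply: contrapT => Psx.
  have [a [b [Pab bsx aF affF ab]]] := facet_separation Ppoly dimP Psx.
  have b0 : 0 <= b by rewrite -(dotp0r a) Pab.
  have [a' [b' [b'01]]] := P01 _ aF; rewrite affF => a'b'.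
  have a'E z : (dotp a z = b) = (dotp (\row_i (a' i)%:~R) z = b'%:~R).
    by rewrite dotp_int_row; have := congr1 (@^~ z) a'b'.
  have [z|c [ca cb]] := ab (\row_i (a' i)%:~R) b'%:~R; first by rewrite a'E.
  have cx : c * dotp a x \is a Num.int.
    by rewrite -dotpZl -ca dotp_lattice //; exact: int_row_lattice.
  have {cx} ctk : c * dotp a x <= t -> c * dotp a x <= k%:R.
    exact: int_le_truncn.
  (* For c = 0 the integral equation would read 0 = 0 and the hyperplane would contain s x. *)
  have c0 : c != 0.
    apply/eqP => c0; move: bsx; rewrite [dotp a _](_ : _ = b) ?ltxx //.
    by rewrite a'E ca cb c0 scale0r mul0r dotp0l.
  have atb : dotp a x <= t * b by rewrite xE dotpZr ler_wpM2l // Pab.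
  suff akb : dotp a x <= k%:R * b.
    have : s * dotp a x <= s * (k%:R * b) by rewrite ler_wpM2l.
    move: bsx; rewrite dotpZr; nra.
  (* If b' = 0 then b = 0 and the dilation factor is immaterial. If b' = 1 then c > 0, and the
     integer c a x is at most t, hence at most k. *)
  case: b'01 => b'E; move: cb; rewrite b'E.
    move/esym/eqP; rewrite mulf_eq0 (negPf c0) => /eqP bE.
    by move: atb; rewrite bE !mulr0.
  move=> cb; have b_gt0 : 0 < b.
    by rewrite lt_def b0 andbT; apply/eqP => bE; move/eqP: cb; rewrite bE mulr0 oner_eq0.
  have c_gt0 : 0 < c by rewrite -(pmulr_lgt0 _ b_gt0) -cb ltr01.
  rewrite -(ler_pM2l c_gt0) mulrCA -cb mulr1; apply: ctk.
  by move: atb; rewrite -(ler_pM2l c_gt0) mulrCA -cb mulr1.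
(* For k = 0 every multiple of x lies in P, which is bounded, so x = 0. *)
have [k0|k0] := eqVneq k 0%N.
  exists 0; rewrite // scaler0; apply: (polytope_bounded Ppoly) => N.
  by apply: Psx; rewrite ?ler0n // k0 mulr0 ler01.
exists (k%:R^-1 *: x); last by rewrite scalerA divff ?scale1r // pnatr_eq0.
by apply: Psx; rewrite ?invr_ge0 // mulVf // pnatr_eq0.
Qed.

(* A weakening of the conclusion of [facet_equations01_truncn] that already
   characterizes [facet_equations01], and whose failure for both summands can be
   combined because two fractional parts at most 1/2 add up to at most 1. *)
Definition half_truncation P := forall x p (k : nat) t,
  @lattice R d x -> P p -> x = t *: p ->
  k%:R <= t -> t <= k%:R + 2^-1 -> exists2 p', P p' & x = k%:R *: p'.

(** A non-integral t has a multiple with fractional part in ]0, 1/2]: t itself, or, if t falls short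
    of the next integer by g < 1/2, its multiple by the least m with m g >= 1/2. Then m g < 1, and
    the fractional part of m t is 1 - m g. *)
Lemma nat_of_multiples (t : R) : 0 <= t ->
  (forall m k : nat, k%:R <= m%:R * t -> m%:R * t <= k%:R + 2^-1 ->
    m%:R * t = k%:R) ->
  exists n : nat, t = n%:R.
Proof.
move=> t0 tP; pose k := Num.truncn t; have /andP[kt tk] := truncn_itv t0.
exists k; have := tP 1%N k; rewrite mul1r; apply=> //.
rewrite leNgt; apply/negP => t_half; pose g := k.+1%:R - t.
have g0 : 0 < g by rewrite subr_gt0.
have g_half : g < 2^-1 by move: t_half; rewrite /g -(addn1 k) natrD; lra.
have exm : exists m : nat, 2^-1 <= m%:R * g.
  exists (Num.bound (2^-1 / g)); rewrite -ler_pdivrMr //.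
  by apply: ltW; apply: archi_boundP; rewrite divr_ge0 // ltW.
case: (ex_minnP exm) => -[|m] mg mmin; first by move: mg; rewrite mul0r; lra.
have {mmin} mg' : m%:R * g < 2^-1.
  by rewrite ltNge; apply/negP => /mmin; rewrite ltnn.
have mE : m.+1%:R = m%:R + 1 :> R by rewrite -(addn1 m) natrD.
have := tP m.+1 (m.+1 * k.+1).-1.
have -> : (m.+1 * k.+1).-1%:R = m.+1%:R * k.+1%:R - 1 :> R.
  by rewrite -natrM -(subn1 (_ * _)) natrB.
have -> : t = k.+1%:R - g by rewrite /g; lra.
rewrite mulrBr; move: mg; rewrite mE mulrDl mul1r.
set u := m%:R * g; rewrite -/u in mg' *; set w := (_ + 1) * k.+1%:R.
by move=> mg /(_ _ _); lra.
Qed.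

End Dilations.

(** * From half truncation to integral facet equations *)

Section FacetEquations.
Context {R : realType} {d : nat}.
Implicit Types (a w x y z : 'rV[R]_d).

Lemma lattice0 : @lattice R d 0.
Proof. by apply/mxOverP => i j; rewrite mxE rpred0. Qed.

Lemma lattice_delta i : @lattice R d (delta_mx 0 i).
Proof. by apply/mxOverP => j k; rewrite mxE rpred_nat. Qed.

(** An affine combination of facet points, each a convex combination of tight generators, is an
    affine combination of tight generators. *)
Lemma hyperplane_comb m (v : 'I_m -> 'rV[R]_d) a b :
  (forall i, dotp a (v i) <= b) ->
  aff (Defs.conv (range v) `&` [set z | dotp a z = b]) =
    [set z | dotp a z = b] ->
  forall y, dotp a y = b -> exists c : 'I_m -> R,
    [/\ forall i, dotp a (v i) != b -> c i = 0, \sum_i c i = 1 &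
      y = \sum_i c i *: v i].
Proof.
move=> avb affE y ay; have : [set z | dotp a z = b] y by [].
rewrite -affE => -[n [c [p [Fp c1 ->]]]].
have /choice[w wP] j : exists w : 'I_m -> R, [/\ forall i, 0 <= w i,
    forall i, dotp a (v i) != b -> w i = 0, \sum_i w i = 1 &
    p j = \sum_i w i *: v i].
  by have [vp ap] := Fp j; exact: (face_comb avb).
exists (fun i => \sum_j c j * w j i); split=> [i avi||].
- by rewrite big1 // => j _; have [_ -> // _ _] := wP j; rewrite mulr0.
- rewrite exchange_big /= -[RHS]c1; apply: eq_bigr => j _.
  by have [_ _ w1 _] := wP j; rewrite -mulr_sumr w1 mulr1.
under eq_bigr => j _ do (have [_ _ _ ->] := wP j; rewrite scaler_sumr).
rewrite exchange_big; apply: eq_bigr => i _; rewrite scaler_suml.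
by apply: eq_bigr => j _; rewrite scalerA.
Qed.

(* Adding a large multiple of the sum of the tight generators moves w into the
   cone over the facet, where dilation factors are the values of a. *)
Lemma facet_normal_integral m (v : 'I_m -> 'rV[R]_d) a :
  let P := Defs.conv (range v) in
  (forall i, @lattice R d (v i)) -> P 0 -> half_truncation P ->
  (forall z, P z -> dotp a z <= 1) ->
  aff (P `&` [set z | dotp a z = 1]) = [set z | dotp a z = 1] -> a != 0 ->
  forall w, @lattice R d w -> dotp a w \is a Num.int.
Proof.
move=> P vZ P0 halfP Pa affE a0 w wZ.
have Pv i : P (v i) by apply: sub_conv; exists i.
have /hyperplane_comb hc : forall i, dotp a (v i) <= 1 by move=> i; exact: Pa.
(* Both [y0] and [w + (1 - dotp a w) *: y0] lie on the hyperplane; eliminating [y0] expresses [w]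
   linearly in the tight generators. *)
have [y0 ay0] := hyperplane_point 1 a0.
have [c0 [c0T _ y0E]] := hc affE y0 ay0.
have [c1 [c1T _ y1E]] : exists c : 'I_m -> R,
    [/\ forall i, dotp a (v i) != 1 -> c i = 0, \sum_i c i = 1 &
      w + (1 - dotp a w) *: y0 = \sum_i c i *: v i].
  by apply: hc => //; rewrite dotpDr dotpZr ay0 mulr1 addrC subrK.
pose c i := c1 i - (1 - dotp a w) * c0 i.
have cT i : dotp a (v i) != 1 -> c i = 0.
  by move=> avi; rewrite /c c0T // c1T // mulr0 subrr.
have wE : w = \sum_i c i *: v i.
  rewrite -[LHS](addrK ((1 - dotp a w) *: y0)) y1E y0E scaler_sumr -sumrB.
  by apply: eq_bigr => i _; rewrite scalerA -scalerBl.
pose N := Num.bound (\sum_i `|c i|).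
have cN i : 0 <= c i + N%:R.
  rewrite -lerBlDl sub0r (le_trans (ler_norm _)) // normrN ltW //.
  apply: le_lt_trans (archi_boundP _); last exact: sumr_ge0.
  by rewrite (bigD1 i) //= lerDl sumr_ge0.
pose T i := dotp a (v i) == 1.
pose x := w + N%:R *: \sum_(i | T i) v i.
have xZ : @lattice R d x.
  apply/mxOverP => i j; rewrite !mxE summxE rpredD ?rpredM ?rpred_nat //.
    by move/mxOverP: wZ.
  by apply: rpred_sum => k _; have /mxOverP := vZ k.
pose e i := if T i then c i + N%:R else 0.
have xE : x = \sum_i e i *: v i.
  rewrite /x {1}wE scaler_sumr [X in _ + X]big_mkcond -big_split.
  apply: eq_bigr => i _; rewrite /e /T; case: eqVneq => [_|/cT ->] /=.
    by rewrite [RHS]scalerDl.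
  by rewrite scale0r addr0.
pose t := \sum_i e i.
have e0 i : 0 <= e i by rewrite /e; case: ifP.
have t0 : 0 <= t by apply: sumr_ge0.
have axt : dotp a x = t.
  rewrite xE dotp_sumr; apply: eq_bigr => i _; rewrite dotpZr /e.
  by case: ifP => [/eqP ->|_]; rewrite ?mulr1 ?mul0r.
have [p Pp xtp] : exists2 p, P p & x = t *: p.
  have [tE|tN0] := eqVneq t 0.
    exists 0 => //; rewrite scaler0 xE big1 // => i _.
    move/eqP: tE; rewrite psumr_eq0 // => /allP /(_ i).
    by rewrite mem_index_enum => /(_ isT) /eqP ->; rewrite scale0r.
  exists (t^-1 *: x); last by rewrite scalerA divff // scale1r.
  apply/conv_rangeP; exists (fun i => t^-1 * e i); split=> [i||].
  - by rewrite mulr_ge0 ?invr_ge0.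
  - by rewrite -mulr_sumr mulVf.
  - by rewrite xE scaler_sumr; apply: eq_bigr => i _; rewrite scalerA.
(* If l t lies in [k, k + 1/2], half truncation puts l x into kP, where a is at most k; hence l t =
   k. *)
have [n tn] : exists n : nat, t = n%:R.
  apply: nat_of_multiples => // l k kt tk; apply/eqP.
  rewrite eq_le kt andbT.
  have lxZ : @lattice R d (l%:R *: x).
    apply/mxOverP => i j; rewrite mxE rpredM ?rpred_nat //.
    by move/mxOverP: xZ.
  have lxE : l%:R *: x = (l%:R * t) *: p by rewrite xtp scalerA.
  have [p' Pp' p'E] := halfP _ _ _ _ lxZ Pp lxE kt tk.
  by rewrite -axt -dotpZr p'E dotpZr ler_piMr // Pa.
have : dotp a w = t - N%:R * #|T|%:R.
  rewrite -axt /x dotpDr dotpZr [dotp a (\sum_(i | T i) _)](_ : _ = #|T|%:R).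
    by rewrite addrK.
  rewrite big_mkcond dotp_sumr -sum1_card natr_sum [RHS]big_mkcond.
  apply: eq_bigr => i _; rewrite unfold_in /T.
  by case: eqVneq => // _; rewrite dotp0r.
by move=> ->; rewrite tn rpredB ?rpredM ?rpred_nat.
Qed.

Lemma rat_int_multiple n (q : 'I_n -> rat) :
  exists (D : int) (r : 'I_n -> int), D != 0 /\ forall i, (r i)%:~R = D%:~R * q i.
Proof.
exists (\prod_i denq (q i)), (fun i => (\prod_(j | j != i) denq (q j)) * numq (q i)).
split=> [|i]; first by apply/prodf_neq0 => i _; exact: denq_neq0.
by rewrite [in RHS](bigD1 i) //= !intrM numqE; ring.
Qed.

(** A homogeneous system with integral coefficients and a nonzero real solution has a nonzero
    rational one, because full rank over the rationals persists over the reals. Clearing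
    denominators makes it integral. *)
Lemma integral_relation m (u : 'I_m -> 'rV[R]_d) a :
  (forall i, @lattice R d (u i)) -> a != 0 -> (forall i, dotp a (u i) = 0) ->
  exists2 r : 'I_d -> int, \row_i (r i)%:~R != 0 :> 'rV[R]_d &
    forall i, dotp (\row_j (r j)%:~R) (u i) = 0.
Proof.
move=> uZ a0 au; pose M : 'M[rat]_(m, d) := \matrix_(i, j) (Num.floor (u i 0 j))%:~R.
have MR : map_mx ratr M = \matrix_(i < m) u i.
  apply/matrixP => i j; rewrite !mxE ratr_int floorK //.
  by have /mxOverP := uZ i.
have K0 : cokermx M != 0.
  apply: contra a0 => K0; have : row_full (map_mx (ratr : rat -> R) M).
    by rewrite -cokermx_eq0 -map_cokermx (eqP K0) map_mx0.
  move=> /row_fullP[B BM]; rewrite -trmx_eq0 -[a^T]mul1mx -BM -mulmxA MR.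
  rewrite [_ *m a^T](_ : _ = 0) ?mulmx0 //; apply/colP => i.
  rewrite !mxE -[RHS](au i); apply: eq_bigr => j _; rewrite !mxE mulrC //.
have [l [k lk]] : exists l k, cokermx M l k != 0.
  apply/not_existsP => Kn; move/eqP: K0; apply; apply/matrixP => l k.
  by rewrite [RHS]mxE; apply/eqP/negP => /negP lk; apply: (Kn l); exists k.
have [D [r [D0 rE]]] := rat_int_multiple (fun l => cokermx M l k).
have rR j : (r j)%:~R = D%:~R * ratr (cokermx M j k) :> R.
  by rewrite -(ratr_int R (r j)) rE rmorphM /= ratr_int.
exists r.
  apply/eqP => /rowP /(_ l) /eqP; rewrite !mxE rR.
  by rewrite mulf_eq0 intr_eq0 fmorph_eq0 (negPf D0) (negPf lk).
move=> i; have := mulmx_coker M => /matrixP /(_ i k); rewrite !mxE => MK.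
rewrite -[RHS](mulr0 (D%:~R)) -[in RHS](rmorph0 (ratr : rat -> R)) -MK.
rewrite rmorph_sum mulr_sumr; apply: eq_bigr => j _; rewrite [in LHS]mxE rR.
rewrite rmorphM [M i j]mxE /= ratr_int floorK; first by ring.
by have /mxOverP := uZ i.
Qed.

(** The hyperplane of a facet through the origin is spanned by lattice points, so it has an integral
    normal. Any other facet is scaled to b = 1, and [facet_normal_integral] at the unit vectors
    yields the coefficients. *)
Lemma half_truncation_facet_equations01 (P : set 'rV[R]_d) :
  integral_polytope P -> has_dim P d -> P 0 -> half_truncation P ->
  facet_equations01 P.
Proof.
move=> [/polytope_vertices[m [v [PE vP]]] vertZ] dimP P0 halfP F PF.
have vZ i : @lattice R d (v i) by apply/vertZ/vP.
have [a [b [a0 Pab FE affF]]] := facet_hyperplane dimP PF.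
have Pv i : P (v i) by rewrite PE; apply: sub_conv; exists i.
have b0 : 0 <= b by rewrite -(dotp0r a) Pab.
have [bE|bN0] := eqVneq b 0.
  (* Generators off the facet are replaced by 0, which imposes no condition on the relation. *)
  pose u i := if dotp a (v i) == 0 then v i else 0.
  have [i|i|r r0 ru] := @integral_relation m u a _ a0.
  - rewrite /u; case: ifP => // _; exact: lattice0.
  - by rewrite /u; case: eqVneq => // _; rewrite dotp0r.
  exists r, 0; split; first by left.
  have [w aw|c rE] := dotp_proportional (a' := \row_i (r i)%:~R) a0.
    have awb : dotp a w = b by rewrite bE.
    have affE : aff (Defs.conv (range v) `&` [set z | dotp a z = b]) =
        [set z | dotp a z = b] by rewrite -PE -FE.
    have [c [cT _ ->]] := hyperplane_comb (fun i => Pab _ (Pv i)) affE awb.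
    rewrite dotp_sumr big1 // => i _; rewrite dotpZr.
    have := ru i; rewrite /u; case: eqVneq => [_ ->|avi _]; first by rewrite mulr0.
    by rewrite cT ?mul0r // bE.
  have c0 : c != 0 by apply: contraNneq r0 => c0; rewrite rE c0 scale0r.
  rewrite affF bE; apply/seteqP; split=> z /=; rewrite -dotp_int_row rE dotpZl.
    by move->; rewrite mulr0.
  by move/eqP; rewrite mulf_eq0 (negPf c0) => /eqP.
have HE z : (dotp (b^-1 *: a) z = 1) = (dotp a z = b).
  apply/propext; rewrite dotpZl; split=> [|->]; last by rewrite mulVf.
  by move=> /(congr1 (fun t => b * t)); rewrite mulrA mulfV // mul1r mulr1.
have HS : [set z | dotp (b^-1 *: a) z = 1] = [set z | dotp a z = b].
  by apply/funext => z /=; rewrite HE.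
have a1Z i : (b^-1 *: a) 0 i \is a Num.int.
  rewrite -dotp_delta; apply: (facet_normal_integral vZ) (lattice_delta i).
  - by rewrite -PE.
  - by rewrite -PE.
  - move=> z; rewrite -PE => /Pab zb; rewrite dotpZl mulrC ler_pdivrMr ?mul1r //.
    by rewrite lt_def bN0.
  - by rewrite HS -PE -FE.
  - by rewrite scaler_eq0 invr_eq0 (negPf bN0).
exists (fun i => Num.floor ((b^-1 *: a) 0 i)), 1; split; first by right.
rewrite affF -HS; apply/funext => z /=; rewrite -dotp_int_row; congr (dotp _ z = _).
by apply/rowP => i; rewrite [RHS]mxE floorK.
Qed.

End FacetEquations.

(** * Free sums *)

Section ConvexDilations.
Context {R : realType} {d : nat}.
Variable P : set 'rV[R]_d.
Hypothesis (cP : convex_set P).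

Lemma dilate_add s t p q : 0 <= s -> 0 <= t -> P p -> P q ->
  exists2 r, P r & s *: p + t *: q = (s + t) *: r.
Proof.
move=> s0 t0 Pp Pq; have [st0|st0] := eqVneq (s + t) 0.
  move/eqP: (st0); rewrite paddr_eq0 // => /andP[/eqP -> /eqP ->].
  by exists p; rewrite // addr0 !scale0r addr0.
exists ((s / (s + t)) *: p + (1 - s / (s + t)) *: q).
  move/convex_setP: cP; apply => //; first by rewrite divr_ge0 // addr_ge0.
  by rewrite ler_pdivrMr ?mul1r ?lerDl // lt_def st0 addr_ge0.
by rewrite scalerDr !scalerA mulrBr mulr1 mulrC divfK // addrAC subrr add0r.
Qed.

Hypothesis P0 : P 0.

(** The missing factor t - s is spent on the origin. *)
Lemma dilate_le s t p : 0 <= s -> s <= t -> P p ->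
  exists2 r, P r & s *: p = t *: r.
Proof.
move=> s0 st Pp; have ts0 : 0 <= t - s by rewrite subr_ge0.
have [r Pr] := dilate_add s0 ts0 Pp P0.
by rewrite scaler0 addr0 subrKC => rE; exists r.
Qed.

Lemma sum_dilate (I : finType) (A : pred I) (h : I -> 'rV[R]_d) :
  (forall i, A i -> P (h i)) ->
  exists2 r, P r & \sum_(i | A i) h i = #|A|%:R *: r.
Proof.
move=> Ph; rewrite -sum1_card natr_sum.
suff: 0 <= \sum_(i in A) 1 :> R /\
    exists2 r, P r & \sum_(i | A i) h i = (\sum_(i in A) 1) *: r by case.
apply: (big_rec2 (fun x c => 0 <= c /\ exists2 r, P r & x = c *: r)) => [|i x c Ai].
  by split=> //; exists 0; rewrite // scaler0.
move=> [c0 [r Pr ->]]; split; first by rewrite addr_ge0.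
have [r' Pr' rE] := dilate_add ler01 c0 (Ph i Ai) Pr.
by exists r'; rewrite // -rE scale1r.
Qed.

End ConvexDilations.

Lemma polytope_convex (R : realType) d (P : set 'rV[R]_d) : polytope P -> convex_set P.
Proof. by move=> [A _ ->]; exact: convex_conv. Qed.

(** The empty sum settles n = 0, which [has_IDP] excludes but which occurs when a dilation factor is
    split. *)
Lemma IDP_dilate (R : realType) d (P : set 'rV[R]_d) n p :
  has_IDP P -> P p -> @lattice R d (n%:R *: p) ->
  exists h : 'I_n -> 'rV[R]_d,
    (forall i, (P `&` @lattice R d) (h i)) /\ n%:R *: p = \sum_i h i.
Proof.
case: n => [|n] IDP Pp pZ; last by apply: IDP => //; split=> //; exists p.
by exists (fun=> 0); split=> [[]|] //; rewrite big_ord0 scale0r.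
Qed.

Section FreeSums.
Context {R : realType} {d e : nat}.
Variables (P : set 'rV[R]_d) (Q : set 'rV[R]_e).
Hypotheses (cP : convex_set P) (cQ : convex_set Q) (P0 : P 0) (Q0 : Q 0).

(** By convexity, the contributions of each summand to a convex combination merge into a single
    point. *)
Lemma free_sumP z : free_sum P Q z <->
  exists s t p q, [/\ 0 <= s, 0 <= t & s + t = 1] /\
    [/\ P p, Q q & z = row_mx (s *: p) (t *: q)].
Proof.
split; last first.
  move=> [s [t [p [q [[s0 t0 st] [Pp Qq ->]]]]]].
  have -> : row_mx (s *: p) (t *: q) = s *: mu e p + (1 - s) *: nu d q.
    by rewrite !scale_row_mx add_row_mx !scaler0 addr0 add0r -st addrC addKr.
  move/convex_setP: (@convex_conv R _ ((@mu R d e @` P) `|` (@nu R d e @` Q))).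
  apply=> //; first by rewrite -st lerDl.
    by apply: sub_conv; left; exists p.
  by apply: sub_conv; right; exists q.
move: z; apply: conv_sub => [|z].
  apply/convex_setP => x y l l0 l1.
  move=> [s [t [p [q [[s0 t0 st] [Pp Qq xE]]]]]].
  move=> [s' [t' [p' [q' [[s'0 t'0 st'] [Pp' Qq' yE]]]]]].
  have l1' : 0 <= 1 - l by rewrite subr_ge0.
  have [p2 Pp2 p2E] := dilate_add cP (mulr_ge0 l0 s0) (mulr_ge0 l1' s'0) Pp Pp'.
  have [q2 Qq2 q2E] := dilate_add cQ (mulr_ge0 l0 t0) (mulr_ge0 l1' t'0) Qq Qq'.
  exists (l * s + (1 - l) * s'), (l * t + (1 - l) * t'), p2, q2; split.
    split; [by rewrite addr_ge0 // mulr_ge0|by rewrite addr_ge0 // mulr_ge0|].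
    by rewrite addrACA -!mulrDr st st' !mulr1 subrKC.
  by split=> //; rewrite xE yE !scale_row_mx add_row_mx !scalerA p2E q2E.
move=> [[p Pp <-]|[q Qq <-]].
  by exists 1, 0, p, 0; rewrite addr0 scale1r scaler0 ler01.
by exists 0, 1, 0, q; rewrite add0r scale1r scaler0 ler01.
Qed.

Lemma free_sum_sub z : free_sum P Q z -> P (lsubmx z) /\ Q (rsubmx z).
Proof.
move=> /free_sumP[s [t [p [q [[s0 t0 st] [Pp Qq ->]]]]]].
rewrite row_mxKl row_mxKr.
have [|p' Pp' ->] := dilate_le cP P0 s0 _ Pp (t := 1); first by rewrite -st lerDl.
have [|q' Qq' ->] := dilate_le cQ Q0 t0 _ Qq (t := 1); first by rewrite -st lerDr.
by rewrite !scale1r.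
Qed.

Lemma dilate_free_sum n s t p q : (0 < n)%N -> 0 <= s -> 0 <= t ->
  s + t <= n%:R -> P p -> Q q ->
  dilate n (free_sum P Q) (row_mx (s *: p) (t *: q)).
Proof.
move=> n0 s0 t0 stn Pp Qq; have nR : 0 < n%:R :> R by rewrite ltr0n.
(* The surplus n - s - t is absorbed by Q, which contains the origin. *)
have [|q' Qq' ->] := dilate_le cQ Q0 t0 _ Qq (t := n%:R - s); first by rewrite lerBrDl.
exists (row_mx ((s / n%:R) *: p) ((1 - s / n%:R) *: q')).
  apply/free_sumP; exists (s / n%:R), (1 - s / n%:R), p, q'; split=> //; split.
  - by rewrite divr_ge0 // ltW.
  - by rewrite subr_ge0 ler_pdivrMr // mul1r; apply: le_trans stn; rewrite lerDl.
  - by rewrite subrKC.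
by rewrite scale_row_mx !scalerA mulrBr mulr1 mulrC divfK // gt_eqF.
Qed.

Lemma dilate_free_sum_inv n g : dilate n (free_sum P Q) g ->
  exists s t p q, [/\ 0 <= s, 0 <= t & s + t = n%:R] /\
    [/\ P p, Q q & g = row_mx (s *: p) (t *: q)].
Proof.
move=> [z /free_sumP[s [t [p [q [[s0 t0 st] [Pp Qq ->]]]]]] <-].
exists (n%:R * s), (n%:R * t), p, q; split.
  by rewrite !mulr_ge0 // -mulrDr st mulr1.
by rewrite scale_row_mx !scalerA.
Qed.

Lemma lattice_row_mx (x : 'rV[R]_d) (y : 'rV[R]_e) :
  @lattice R (d + e) (row_mx x y) <-> @lattice R d x /\ @lattice R e y.
Proof.
split=> [/mxOverP xyZ|[/mxOverP xZ /mxOverP yZ]].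
  split; apply/mxOverP => i j.
    by have := xyZ i (lshift e j); rewrite row_mxEl.
  by have := xyZ i (rshift d j); rewrite row_mxEr.
apply/mxOverP => i j; rewrite mxE; case: splitP => k _; [exact: xZ|exact: yZ].
Qed.

(** A lattice point of a dilated summand is embedded, decomposed and projected back. The other
    component is written [0 *: 0] to fit [dilate_free_sum]. *)
Lemma free_sum_IDP_summands : has_IDP (free_sum P Q) -> has_IDP P /\ has_IDP Q.
Proof.
move=> IDP; split=> n n0 _ [[z zP <-] gZ].
  have [|h [hPQ hE]] := IDP n n0 (row_mx (n%:R *: z) (0 *: 0)).
    split; last by rewrite scaler0; apply/lattice_row_mx; split=> //; exact: lattice0.
    by apply: dilate_free_sum; rewrite ?ler0n // addr0.
  exists (fun i => lsubmx (h i)); split=> [i|].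
    have [/free_sum_sub[Ph _]] := hPQ i.
    by rewrite -{1}[h i]hsubmxK => /lattice_row_mx[hZ _].
  by rewrite -[LHS](row_mxKl _ (0 *: (0 : 'rV[R]_e))) hE linear_sum.
have [|h [hPQ hE]] := IDP n n0 (row_mx (0 *: 0) (n%:R *: z)).
  split; last by rewrite scaler0; apply/lattice_row_mx; split=> //; exact: lattice0.
  by apply: dilate_free_sum; rewrite ?ler0n // add0r.
exists (fun i => rsubmx (h i)); split=> [i|].
  have [/free_sum_sub[_ Qh]] := hPQ i.
  by rewrite -{1}[h i]hsubmxK => /lattice_row_mx[_ hZ].
by rewrite -[LHS](row_mxKr (0 *: (0 : 'rV[R]_d))) hE linear_sum.
Qed.

Lemma free_sum_IDP_half_truncation :
  free_sum P Q `&` @lattice R (d + e) =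
    (@mu R d e @` (P `&` @lattice R d)) `|` (@nu R d e @` (Q `&` @lattice R e)) ->
  has_IDP (free_sum P Q) -> half_truncation P \/ half_truncation Q.
Proof.
move=> hPQ IDP; apply: contrapT => /not_orP[nP nQ]; apply: nP => x p k s xZ Pp xE ks sk.
apply: contrapT => nx; apply: nQ => y q l t yZ Qq yE lt tl.
apply: contrapT => ny.
have s0 : 0 <= s := le_trans (ler0n _ _) ks.
have t0 : 0 <= t := le_trans (ler0n _ _) lt.
(* The excesses of s over k and of t over l are at most 1/2 each, so s + t <= k + l + 1. *)
have [//||h [hP hE]] := IDP (k + l).+1 _ (row_mx x y).
  split; last by apply/lattice_row_mx.
  rewrite xE yE; apply: dilate_free_sum => //.
  by rewrite -(addn1 (k + l)) !natrD; lra.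
(* A summand at the origin counts for P; by [hPQ] all summands outside [A] come from Q. *)
pose A := [pred i | `[< exists2 p, P p & h i = mu e p >]].
have hA i : A i -> P (lsubmx (h i)) /\ rsubmx (h i) = 0.
  by move=> /asboolP[r Pr ->]; rewrite row_mxKl row_mxKr.
have hNA i : ~~ A i -> Q (rsubmx (h i)) /\ lsubmx (h i) = 0.
  move=> /asboolP Ai; have := hP i; rewrite hPQ => -[[r [Pr _] rE]|[r [Qr _] <-]].
    by case: Ai; exists r.
  by rewrite row_mxKl row_mxKr.
have [p' Pp' p'E] := sum_dilate cP P0 (A := A) (fun i Ai => (hA i Ai).1).
have [q' Qq' q'E] := sum_dilate cQ Q0 (A := [predC A]) (fun i Ai => (hNA i Ai).1).
have xA : x = #|A|%:R *: p'.
  rewrite -p'E -[LHS](row_mxKl _ y) hE linear_sum (bigID A) /=.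
  by rewrite [X in _ + X]big1 ?addr0 // => i /hNA[].
have yA : y = #|[predC A]|%:R *: q'.
  rewrite -q'E -[LHS](row_mxKr x) hE linear_sum (bigID A) /=.
  by rewrite big1 ?add0r // => i /hA[].
have cardA := cardC A; rewrite card_ord in cardA.
(* Of the k + l + 1 summands, at most k lie in [A] or at most l outside, so x is in kP or y is in
   lQ. *)
have [Ak|kA] := leqP #|A| k.
  apply: nx; rewrite xA; apply: (dilate_le cP P0) => //.
  by rewrite ler_nat.
apply: ny; rewrite yA; apply: (dilate_le cQ Q0) => //.
rewrite ler_nat -(leq_add2l #|A|) [leqLHS]cardA; exact: leq_add kA (leqnn l).
Qed.

(** The last hypothesis isolates the replacement of real factors s, t by integers with the same sum,
    which facet equations of either summand provide. *)
Lemma free_sum_IDP :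
  has_IDP P -> has_IDP Q ->
  (forall n s t p q, s + t = n%:R -> 0 <= s -> 0 <= t -> P p -> Q q ->
    @lattice R d (s *: p) -> @lattice R e (t *: q) ->
    exists k l p' q', [/\ (k + l)%N = n, P p', Q q', s *: p = k%:R *: p' &
      t *: q = l%:R *: q']) ->
  has_IDP (free_sum P Q).
Proof.
move=> IDP IDQ split_n n n0 g [/dilate_free_sum_inv].
move=> [s [t [p [q [[s0 t0 st] [Pp Qq ->]]]]]] /lattice_row_mx[pZ qZ].
have [k [l [p' [q' [kl Pp' Qq' pE qE]]]]] := split_n _ _ _ _ _ st s0 t0 Pp Qq pZ qZ.
rewrite pE in pZ *; rewrite qE in qZ *; subst n.
have [h [hP ->]] := IDP_dilate IDP Pp' pZ.
have [h' [h'Q ->]] := IDP_dilate IDQ Qq' qZ.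
exists (fun i => match fintype.split i with
                 | inl j => mu e (h j) | inr j => nu d (h' j) end).
split=> [i|].
  case: fintype.splitP => j _.
    have [Ph hZ] := hP j; split; last by apply/lattice_row_mx; split=> //; exact: lattice0.
    by apply: sub_conv; left; exists (h j).
  have [Qh hZ] := h'Q j; split; last by apply/lattice_row_mx; split=> //; exact: lattice0.
  by apply: sub_conv; right; exists (h' j).
rewrite big_split_ord /=.
under [X in _ = X + _]eq_bigr => i _
  do rewrite -[lshift l i]/(unsplit (inl i)) unsplitK.
under [X in _ = _ + X]eq_bigr => i _
  do rewrite -[rshift k i]/(unsplit (inr i)) unsplitK.
have muD : {morph @mu R d e : x y / x + y}.
  by move=> x y; rewrite /mu add_row_mx addr0.
have nuD : {morph @nu R d e : x y / x + y}.
  by move=> x y; rewrite /nu add_row_mx addr0.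
rewrite -(big_morph _ muD (row_mx0 _ _ _ _)) -(big_morph _ nuD (row_mx0 _ _ _ _)).
by rewrite /mu /nu add_row_mx addr0 add0r.
Qed.

End FreeSums.

(** The factor s drops to its integer part k, and Q takes n - k >= t by means of its origin; hence a
    facet condition on one summand suffices. *)
Lemma split_dilations (R : realType) d e (P : set 'rV[R]_d) (Q : set 'rV[R]_e)
    n s t p q :
  polytope P -> has_dim P d -> P 0 -> facet_equations01 P ->
  convex_set Q -> Q 0 ->
  s + t = n%:R -> 0 <= s -> 0 <= t -> P p -> Q q -> @lattice R d (s *: p) ->
  exists k l p' q', [/\ (k + l)%N = n, P p', Q q', s *: p = k%:R *: p' &
    t *: q = l%:R *: q'].
Proof.
move=> Ppoly dimP P0 P01 cQ Q0 st s0 t0 Pp Qq pZ.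
have [p' Pp' p'E] := facet_equations01_truncn Ppoly dimP P0 P01 pZ Pp s0 erefl.
set k := Num.truncn s in p'E; have /andP[ks _] := truncn_itv s0.
have kn : (k <= n)%N by rewrite -(ler_nat R) -st (le_trans ks) // lerDl.
have [|q' Qq' q'E] := dilate_le cQ Q0 t0 _ Qq (t := (n - k)%:R).
  by rewrite natrB // -st; move: ks; rewrite -/k; lra.
by exists k, (n - k)%N, p', q'; rewrite subnKC.
Qed.

Theorem theorem0p1 (R : realType) (d e : nat) (hd : (1 <= d)%N) (he : (1 <= e)%N)
    (P : set 'rV[R]_d) (Q : set 'rV[R]_e)
    (hP : integral_polytope P) (hQ : integral_polytope Q)
    (dimP : has_dim P d) (dimQ : has_dim Q e)
    (P0 : P 0) (Q0 : Q 0)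
    (ZP : ZZspan (P `&` @lattice R d) = @lattice R d)
    (ZQ : ZZspan (Q `&` @lattice R e) = @lattice R e)
    (hPQ : free_sum P Q `&` @lattice R (d + e) =
           (@mu R d e @` (P `&` @lattice R d)) `|`
           (@nu R d e @` (Q `&` @lattice R e))) :
  has_IDP (free_sum P Q) <->
  (has_IDP P /\ has_IDP Q) /\ (facet_equations01 P \/ facet_equations01 Q).
Proof.
have cP := polytope_convex hP.1; have cQ := polytope_convex hQ.1.
split=> [IDP|[[IDP IDQ] P01Q01]].
  split; first exact: free_sum_IDP_summands.
  have [halfP|halfQ] := free_sum_IDP_half_truncation cP cQ P0 Q0 hPQ IDP.
    by left; apply: half_truncation_facet_equations01.
  by right; apply: half_truncation_facet_equations01.
apply: free_sum_IDP => // n s t p q st s0 t0 Pp Qq pZ qZ.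
case: P01Q01 => [P01|Q01].
  exact: (split_dilations hP.1 dimP P0 P01 cQ Q0 st s0 t0 Pp Qq pZ).
(* The same splitting with the roles of P and Q exchanged. *)
rewrite addrC in st.
have [l [k [q' [p' [lk Qq' Pp' qE pE]]]]] :=
  split_dilations hQ.1 dimQ Q0 Q01 cP P0 st t0 s0 Qq Pp qZ.
by exists k, l, p', q'; rewrite addnC.
Qed.
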